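(* Let $\mathcal{S}$ be a finite state space, let $\pi_{\mathrm{pre}}(\cdot\mid\cdot)$ be a transition kernel on $\mathcal{S}$, let $r:\mathcal{S}\times\mathcal{S}\to\mathbb{R}$ be a reward function, let $\beta>0$, and let $p_{\mathrm{data}}$ be a probability distribution on $\mathcal{S}$. Let $$T(g\mid f)=\pi_{\mathrm{inst}}(g\mid f)=\frac{1}{Z(f)}\,\pi_{\mathrm{pre}}(g\mid f)\exp\!\Big(\frac{r(f,g)}{\beta}\Big),\qquad Z(f)=\sum_{g'\in\mathcal{S}}\pi_{\mathrm{pre}}(g'\mid f)\exp\!\Big(\frac{r(f,g')}{\beta}\Big).$$ Let $E\subseteq\mathcal{S}\times\mathcal{S}$ be a symmetric set of pairs (the state pairs under consideration), such that for every $(f,g)\in E$ the quantities $\pi_{\mathrm{pre}}(g\mid f),\pi_{\mathrm{pre}}(f\mid g),p_{\mathrm{data}}(f),p_{\mathrm{data}}(g)$ are positive. Assume: (1) there is a function $h:\mathcal{S}\to\mathbb{R}$ such that $r(f,g)=h(g)-h(f)$ for all $(f,g)\in E$; (2) for all $(f,g)\in E$, $$\log\frac{\pi_{\mathrm{pre}}(g\mid f)}{\pi_{\mathrm{pre}}(f\mid g)}=\log\frac{p_{\mathrm{data}}(g)}{p_{\mathrm{data}}(f)}.$$ Then there exists a function $V:\mathcal{S}\to\mathbb{R}$ such that for all $(f,g)\in E$, $$\log\frac{T(g\mid f)}{T(f\mid g)}=V(f)-V(g).$$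
   Context: A transition kernel $\pi(\cdot\mid\cdot)$ on a finite set $\mathcal{S}$ assigns to every $f\in\mathcal{S}$ a probability distribution $\pi(\cdot\mid f)$ on $\mathcal{S}$. The kernel $\pi_{\mathrm{inst}}$ (the instruction-tuned model) is the optimal policy of KL-regularized reward maximization with reward $r$, regularization strength $\beta$ and reference model $\pi_{\mathrm{pre}}$; it is given by the closed form in the claim. *)

(* Defs.v *)
From HB Require Import structures.
From mathcomp Require Import all_boot all_order all_algebra.
From mathcomp Require Import reals.
From mathcomp.analysis Require Import sequences exp.

Set Implicit Arguments.
Unset Strict Implicit.
Unset Printing Implicit Defensive.

Import Order.TTheory GRing.Theory Num.Theory.
Local Open Scope ring_scope.

Definition is_distribution (R : realType) (S : finType) (p : S -> R) : Prop :=
  (forall x : S, 0 <= p x) /\ \sum_(x : S) p x = 1.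

(* Kernels take the conditioning state first: [pi f g] is pi(g | f). *)
Definition is_kernel (R : realType) (S : finType) (pi : S -> S -> R) : Prop :=
  forall f : S, is_distribution (pi f).

Definition partition_fun (R : realType) (S : finType)
    (pi_pre r : S -> S -> R) (beta : R) (f : S) : R :=
  \sum_(g : S) pi_pre f g * expR (r f g / beta).

Definition pi_inst (R : realType) (S : finType)
    (pi_pre r : S -> S -> R) (beta : R) (f g : S) : R :=
  (partition_fun pi_pre r beta f)^-1 * pi_pre f g * expR (r f g / beta).

(* Main.v *)
(* Along E the logarithm of T(g|f)/T(f|g) splits into three differences: the
   partition functions give log Z(g) - log Z(f), the reference kernel gives
   log p_data(g) - log p_data(f), and the reward, being antisymmetric on E,
   gives 2 (h(g) - h(f)) / beta. So V = - log Z - log p_data - 2 h / beta. *)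
Require Import Defs.
From HB Require Import structures.
From mathcomp Require Import all_boot all_order all_algebra.
From mathcomp Require Import reals.
From mathcomp.analysis Require Import sequences exp.
From mathcomp Require Import ring.

Set Implicit Arguments.
Unset Strict Implicit.
Unset Printing Implicit Defensive.

Import Order.TTheory GRing.Theory Num.Theory.
Local Open Scope ring_scope.

(** One strictly positive term is enough, since the remaining terms are nonnegative. *)
Lemma partition_fun_gt0 (R : realType) (S : finType)
    (pi_pre r : S -> S -> R) (beta : R) (f g : S) :
  (forall x : S, 0 <= pi_pre f x) -> 0 < pi_pre f g ->
  0 < partition_fun pi_pre r beta f.
Proof.
move=> pi_ge0 pi_gt0; rewrite /partition_fun (bigD1 g) //=.
rewrite ltr_pwDl ?mulr_gt0 ?expR_gt0 //.
by apply: sumr_ge0 => x _; rewrite mulr_ge0 ?expR_ge0.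
Qed.

Lemma ln_pi_inst (R : realType) (S : finType)
    (pi_pre r : S -> S -> R) (beta : R) (f g : S) :
  0 < partition_fun pi_pre r beta f -> 0 < pi_pre f g ->
  ln (pi_inst pi_pre r beta f g) =
  ln (pi_pre f g) + r f g / beta - ln (partition_fun pi_pre r beta f).
Proof.
move=> Z_gt0 pi_gt0; rewrite /pi_inst.
rewrite !lnM ?posrE ?mulr_gt0 ?invr_gt0 ?expR_gt0 //.
by rewrite lnV ?posrE // expRK addrC addrA addrAC [_ + ln (pi_pre f g)]addrC addrAC.
Qed.

Theorem theorem4p3 (R : realType) (S : finType)
  (pi_pre : S -> S -> R) (r : S -> S -> R) (beta : R) (p_data : S -> R)
  (E : {set S * S})
  (pi_pre_kernel : is_kernel pi_pre)
  (beta_gt0 : 0 < beta)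
  (p_data_dist : is_distribution p_data)
  (E_sym : forall f g : S, (f, g) \in E -> (g, f) \in E)
  (E_pos : forall f g : S, (f, g) \in E ->
    [/\ 0 < pi_pre f g, 0 < pi_pre g f, 0 < p_data f & 0 < p_data g])
  (r_potential : exists h : S -> R,
    forall f g : S, (f, g) \in E -> r f g = h g - h f)
  (pre_balance : forall f g : S, (f, g) \in E ->
    ln (pi_pre f g / pi_pre g f) = ln (p_data g / p_data f)) :
  let T := pi_inst pi_pre r beta in
  exists V : S -> R, forall f g : S, (f, g) \in E ->
    ln (T f g / T g f) = V f - V g.
Proof.
move=> T; have [h rE] := r_potential.
pose Z := partition_fun pi_pre r beta.
exists (fun f => - (ln (Z f) + ln (p_data f) + 2 * h f / beta)) => f g Efg.
have Egf := E_sym _ _ Efg.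
have [pi_fg pi_gf p_f p_g] := E_pos _ _ Efg.
(* The pair itself supplies the positive term: [g] in the sum [Z f], [f] in the sum [Z g]. *)
have Zf : 0 < Z f by apply: partition_fun_gt0 pi_fg; have [] := pi_pre_kernel f.
have Zg : 0 < Z g by apply: partition_fun_gt0 pi_gf; have [] := pi_pre_kernel g.
have Tfg : 0 < T f g by rewrite !mulr_gt0 ?invr_gt0 ?expR_gt0.
have Tgf : 0 < T g f by rewrite !mulr_gt0 ?invr_gt0 ?expR_gt0.
(* This splits the quotients both in the balance condition and in the goal. *)
have := pre_balance _ _ Efg; rewrite !ln_div ?posrE // => balance.
(* [Egf] gives the potential form of [r g f] as well; the two rewards are opposite, whence the
   factor 2 in the witness. *)
rewrite !ln_pi_inst // -/(Z f) -/(Z g) !rE //.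
(* Now [ln (pi_pre g f)] cancels, leaving an identity linear in the logarithms. *)
have -> : ln (pi_pre f g) = ln (pi_pre g f) + (ln (p_data g) - ln (p_data f)).
  by rewrite -balance addrC subrK.
by ring.
Qed.
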